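(* Assume hypotheses (H1), (H2), (H3) of the context, and let $(\boldsymbol u_h,\varrho_h,\varsigma_h,\beta_h)$ be a solution of the semi-discrete scheme (S) of the context such that $d\beta_h(t=0)=0$. Then $d\beta_h(t)=0$ (that is, $\operatorname{div}\boldsymbol B_h=0$, where $\boldsymbol B_h$ is the vector proxy of the $(n-1)$-form $\beta_h$) for all $t$.
   Context: Setting. $\Omega\subset\mathbb{R}^n$ ($n=2,3$) is a domain with boundary $\partial\Omega$ regular enough for Stokes' theorem; $X(\Omega)$ is the set of vector fields on $\Omega$ tangent to $\partial\Omega$. $d$ is the exterior derivative, $\star$ the Hodge operator, $i_{\boldsymbol u}$ the interior product with a vector field $\boldsymbol u$. $e=e(\rho,s)$ is a given smooth function (internal energy), with partial derivatives $\partial_\rho e$, $\partial_s e$. An $n$-form $\varrho=\rho\,dV$ is identified with its scalar density $\rho$ whenever it is an argument of $e$ or multiplies another $n$-form or a vector field inside an integrand; e.g. $\int_\Omega(\varrho\boldsymbol u)\cdot\boldsymbol v=\int_\Omega\rho\,\boldsymbol u\cdot\boldsymbol v\,dV$. (H1) $V_h^0,\dots,V_h^n$ are finite-dimensional spaces, $V_h^i$ consisting of $i$-forms on $\Omega$ on which $d$ is well defined, with $d(V_h^i)\subset V_h^{i+1}$. (H2) There are linear projection operators $\Pi^i$ onto $V_h^i$, $0\le i\le n$ (with domain containing all the forms to which they are applied below), which preserve the vanishing of forms at the boundary: if $\alpha$ has vanishing trace (pullback) on $\partial\Omega$, so does $\Pi^i\alpha$. $X_h\subset X(\Omega)$ is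 a finite-dimensional vector space of discrete vector fields. Let $$\mathfrak g_h=\{(A^0,\dots,A^n)\in L(V_h^0)\times\cdots\times L(V_h^n):\ dA^{i-1}=A^i d\},$$ with $L(V)$ the linear endomorphisms of $V$, and bracket $[A,B]^i=A^iB^i-B^iA^i$. For $\boldsymbol u_h\in X_h$, $A_{\boldsymbol u_h}=(A^0_{\boldsymbol u_h},\dots,A^n_{\boldsymbol u_h})\in\mathfrak g_h$ is defined by $$A^i_{\boldsymbol u_h}\alpha_h=d\,\Pi^{i-1}(i_{\boldsymbol u_h}\alpha_h)+\Pi^i(i_{\boldsymbol u_h}d\alpha_h),\qquad \alpha_h\in V_h^i,$$ (the first term is $0$ for $i=0$, the second is $0$ for $i=n$). (H3) The map $\boldsymbol u_h\mapsto A_{\boldsymbol u_h}$ from $X_h$ to $\mathfrak g_h$ is injective and a linear left inverse $\hat{\cdot}:\mathfrak g_h\to X_h$ is fixed: $\widehat{A_{\boldsymbol u_h}}=\boldsymbol u_h$ for all $\boldsymbol u_h\in X_h$. Semi-discrete scheme (S): find (smooth in time) curves $\boldsymbol u_h(t)\in X_h$, $\varrho_h(t),\varsigma_h(t)\in V_h^n$, $\beta_h(t)\in V_h^{n-1}$ such that $$ \int_\Omega \partial_t(\varrho_h\boldsymbol{u}_h)\cdot\boldsymbol{v}_h-(\varrho_h\boldsymbol{u}_h)\cdot\widehat{[A_{\boldsymbol{v}_h},A_{\boldsymbol{u}_h}]}+\Big(\tfrac12|\boldsymbol{u}_h|^2-e(\varrho_h,\varsigma_h)-\varrho_h\partial_{\varrho_h}e(\varrho_h,\varsigma_h)\Big)A^n_{\boldsymbol{v}_h}\varrho_h-\varrho_h\partial_{\varsigma_h}e(\varrho_h,\varsigma_h)A^n_{\boldsymbol{v}_h}\varsigma_h-\beta_h\wedge\star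 A^{n-1}_{\boldsymbol{v}_h}\beta_h=0\quad\forall\,\boldsymbol v_h\in X_h, $$ $$ \partial_t\varrho_h+A^n_{\boldsymbol u_h}\varrho_h=0,\qquad \partial_t\varsigma_h+A^n_{\boldsymbol u_h}\varsigma_h=0,\qquad \partial_t\beta_h+A^{n-1}_{\boldsymbol u_h}\beta_h=0 . $$ *)

(* Defs.v *)
From HB Require Import structures.
From mathcomp Require Import all_boot all_order all_algebra.
From mathcomp Require Import all_classical all_reals all_analysis.

Set Implicit Arguments.
Unset Strict Implicit.
Unset Printing Implicit Defensive.

Import Order.TTheory GRing.Theory Num.Theory.
Import numFieldNormedType.Exports.

Local Open Scope classical_set_scope.
Local Open Scope ring_scope.

(* ** Lebesgue measure on R^n *)

Definition rV_display : measure_display. Proof. exact: default_measure_display. Qed.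

Section measurable_rV.
Context (R : realType) (n : nat).

Definition rV_measurable : set (set 'rV[R]_n) :=
  g_sigma_preimage (fun (i : 'I_n) (x : 'rV[R]_n) => x 0 i).

Let rV0 : rV_measurable set0. Proof. exact: sigma_algebra0. Qed.

Let rVC A : rV_measurable A -> rV_measurable (~` A).
Proof. exact: sigma_algebraC. Qed.

Let rVU (F : (set 'rV[R]_n)^nat) :
  (forall i, rV_measurable (F i)) -> rV_measurable (\bigcup_i F i).
Proof. exact: sigma_algebra_bigcup. Qed.

HB.instance Definition _ :=
  @isMeasurable.Build rV_display 'rV[R]_n rV_measurable rV0 rVC rVU.

End measurable_rV.

Section lebesgue_rV.
Context (R : realType).

Lemma measurable_rV_coord n (i : 'I_n) :
  measurable_fun [set: 'rV[R]_n] (fun x : 'rV[R]_n => x 0 i).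
Proof.
move=> _ Y mY; rewrite setTI; apply: sub_sigma_algebra => /=.
rewrite -bigcup_seq/=; exists i => /=; first by rewrite mem_index_enum.
by exists Y => //; rewrite setTI.
Qed.

Lemma measurable_rVP d (T : measurableType d) n (f : T -> 'rV[R]_n) :
  (forall i, measurable_fun [set: T] (fun x => f x 0 i)) ->
  measurable_fun [set: T] f.
Proof.
move=> mf.
have H : @measurable _ 'rV[R]_n `<=` [set A | measurable (f @^-1` A)].
  apply: smallest_sub.
  - split=> /=.
    + by rewrite preimage_set0.
    + by move=> A mA; rewrite setTD preimage_setC; exact: measurableC.
    + by move=> F mF; rewrite preimage_bigcup; exact: bigcup_measurable.
  - move=> A; rewrite -bigcup_seq/= => -[i _ [B mB <-]] /=.
    by rewrite setTI -comp_preimage -[X in measurable X]setTI; exact: mf.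
by move=> _ A /H; rewrite setTI.
Qed.

Definition cons_rV n (p : R * 'rV[R]_n) : 'rV[R]_n.+1 :=
  \row_i if unlift ord0 i is Some j then p.2 0 j else p.1.

Definition uncons_rV n (x : 'rV[R]_n.+1) : R * 'rV[R]_n :=
  (x 0 ord0, \row_i x 0 (lift ord0 i)).

Lemma cons_rVK n : cancel (@cons_rV n) (@uncons_rV n).
Proof.
move=> [a x]; rewrite /uncons_rV /cons_rV mxE unlift_none; congr pair.
by apply/rowP => i; rewrite !mxE liftK.
Qed.

Lemma measurable_cons_rV n : measurable_fun [set: R * 'rV[R]_n] (@cons_rV n).
Proof.
apply: measurable_rVP => i.
under eq_fun do rewrite mxE.
case: unliftP => [j _|_]; last exact: measurable_fst.
by apply: (measurableT_comp (measurable_rV_coord j)); exact: measurable_snd.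
Qed.

Lemma measurable_uncons_rV n :
  measurable_fun [set: 'rV[R]_n.+1] (@uncons_rV n).
Proof.
apply: measurable_fun_pair; first exact: measurable_rV_coord.
apply: measurable_rVP => i.
under eq_fun do rewrite mxE.
exact: measurable_rV_coord.
Qed.

(* Lebesgue measure on R^(n+1) is the product of those on R and R^n. *)
Section step.
Context (n : nat) (m : {sigma_finite_measure set 'rV[R]_n -> \bar R}).

Definition lebesgue_cons : set 'rV[R]_n.+1 -> \bar R :=
  pushforward (lebesgue_measure \x m)%E (@cons_rV n).

Let lebesgue_cons0 : lebesgue_cons set0 = 0%E.
Proof. by rewrite /lebesgue_cons /pushforward preimage_set0 measure0. Qed.

Let lebesgue_cons_ge0 A : (0 <= lebesgue_cons A)%E.
Proof. by rewrite /lebesgue_cons /pushforward measure_ge0. Qed.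

Let lebesgue_cons_sigma_additive : semi_sigma_additive lebesgue_cons.
Proof.
have mcons A : measurable A -> measurable (@cons_rV n @^-1` A).
  by move=> mA; rewrite -[X in measurable X]setTI; exact: measurable_cons_rV.
move=> F mF tF mUF; rewrite /lebesgue_cons /pushforward preimage_bigcup.
apply: measure_semi_sigma_additive => //.
- by move=> k; exact: mcons.
- apply/trivIsetP => i j _ _ ij; rewrite -preimage_setI.
  by move/trivIsetP : tF => /(_ _ _ _ _ ij) ->//; rewrite preimage_set0.
- by rewrite -preimage_bigcup; exact: mcons.
Qed.

HB.instance Definition _ := isMeasure.Build _ _ _ lebesgue_cons
  lebesgue_cons0 lebesgue_cons_ge0 lebesgue_cons_sigma_additive.

Let lebesgue_cons_sigma_finite : sigma_finite setT lebesgue_cons.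
Proof.
have /sigma_finiteP[F [FT ndF Foo]] := sigma_finiteT (@lebesgue_measure R).
have /sigma_finiteP[G [GT ndG Goo]] := sigma_finiteT m.
exists (fun k => @uncons_rV n @^-1` (F k `*` G k)).
  apply/esym/seteqP; split => // x _.
  have [k _ Fk] : (\bigcup_i F i) (uncons_rV x).1 by rewrite -FT.
  have [l _ Gl] : (\bigcup_i G i) (uncons_rV x).2 by rewrite -GT.
  exists (maxn k l) => //; split.
  - by move: Fk; exact/subsetPset/ndF/leq_maxl.
  - by move: Gl; exact/subsetPset/ndG/leq_maxr.
move=> k; have [mF Fk] := Foo k; have [mG Gk] := Goo k; split.
  rewrite -[X in measurable X]setTI; apply: measurable_uncons_rV => //.
  exact: measurableX.
rewrite /lebesgue_cons /pushforward -comp_preimage.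
rewrite (_ : _ \o _ = id); last by apply/funext => p /=; rewrite cons_rVK.
by rewrite preimage_id product_measure1E// lte_mul_pinfty// ge0_fin_numE.
Qed.

HB.instance Definition _ :=
  Measure_isSigmaFinite.Build _ _ _ lebesgue_cons lebesgue_cons_sigma_finite.

End step.

Fixpoint lebesgue_rV n : {sigma_finite_measure set 'rV[R]_n -> \bar R} :=
  if n is n'.+1 return {sigma_finite_measure set 'rV[R]_n -> \bar R}
  then lebesgue_cons (lebesgue_rV n')
  else \d_(0 : 'rV[R]_0).

End lebesgue_rV.

(* ** Exterior algebra and differential forms on R^n

   A (mixed-degree) covector is given by its coordinates in the basis dx_S,
   where S ranges over the subsets of {0, .., n-1} and dx_S is the wedge product
   of the dx_i, i in S, taken in increasing order.  A form is a field of
   covectors. *)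

Notation covector R n := ({set 'I_n} -> R^o).
Notation form R n := ('rV[R]_n -> {set 'I_n} -> R^o).
Notation vfield R n := ('rV[R]_n -> 'rV[R]_n).

Section forms.
Context (R : realType) (n : nat).
Implicit Types (a b : covector R n) (w : form R n) (S U : {set 'I_n}).
Implicit Types (u v : 'rV[R]_n).

(* dx_S /\ dx_U = sgn S U dx_(S :|: U) for disjoint S and U. *)
Definition sgn S U : R :=
  (-1) ^+ #|[set p : 'I_n * 'I_n | [&& p.1 \in S, p.2 \in U & (p.2 < p.1)%N]]%SET|.

Definition wedge a b : covector R n := fun U =>
  \sum_(S : {set 'I_n} | S \subset U)
    sgn S (U :\: S)%SET * a S * b (U :\: S)%SET.

Definition hodge a : covector R n := fun U => sgn (~: U)%SET U * a (~: U)%SET.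

Definition contract v a : covector R n := fun U =>
  \sum_(j | j \notin U) sgn [set j]%SET U * v 0 j * a (j |: U)%SET.

Definition flat v : covector R n := fun U =>
  \sum_j (if U == [set j]%SET then v 0 j else 0).

Definition top_coef a : R := a [set: 'I_n]%SET.

Definition dotv u v : R := \sum_j u 0 j * v 0 j.

Definition iprod (X : vfield R n) w : form R n := fun x => contract (X x) (w x).

Definition pder (j : 'I_n) (f : 'rV[R]_n -> R) : 'rV[R]_n -> R :=
  'D_(delta_mx 0 j) f.

Definition iter_pder (s : seq 'I_n) (f : 'rV[R]_n -> R) : 'rV[R]_n -> R :=
  foldr pder f s.

(* f is C^oo on the open set D. *)
Definition smooth_on (D : set 'rV[R]_n) (f : 'rV[R]_n -> R) :=
  forall (s : seq 'I_n) x, D x ->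
    {for x, continuous (iter_pder s f)} /\
    forall j, derivable (iter_pder s f) x (delta_mx 0 j).

(* Classical exterior derivative, meaningful on smooth forms:
   dw = sum_j dx_j /\ (partial_j w). *)
Definition ext_d w : form R n := fun x U =>
  \sum_(j in U) sgn [set j]%SET (U :\ j)%SET
                * pder j (fun y => w y (U :\ j)%SET) x.

Definition test_form (D : set 'rV[R]_n) w :=
  (forall S, smooth_on setT (fun x => w x S)) /\
  exists K, [/\ compact K, K `<=` D & forall x S, ~ K x -> w x S = 0].

Local Notation leb := (lebesgue_rV R n).

Definition int_form (D : set 'rV[R]_n) w : R := \int[leb]_(x in D) top_coef (w x).

Section domain.
Context (D : set 'rV[R]_n).

Definition kform (k : nat) w :=
  (forall x S, D x -> #|S| != k -> w x S = 0) /\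
  forall S, measurable_fun D (fun x => w x S) /\
    forall K, compact K -> K `<=` D ->
      leb.-integrable K (EFin \o (fun x => w x S)).

(* Forms need not be continuous, so they are identified when they define the
   same current (for locally integrable forms: when they agree almost
   everywhere), and d is taken in the sense of currents.  Test forms are of
   mixed degree: only their component of complementary degree matters. *)
Definition form_eq w w' := forall phi, test_form D phi ->
  int_form D (fun x => wedge (w x) (phi x)) =
  int_form D (fun x => wedge (w' x) (phi x)).

Definition is_ext_d (k : nat) w dw := forall phi, test_form D phi ->
  int_form D (fun x => wedge (dw x) (phi x)) =
  (-1) ^+ k.+1 * int_form D (fun x => wedge (w x) (ext_d phi x)).

Definition bdry : set 'rV[R]_n := closure D `\` D.

(* Domain whose boundary, with surface measure sigma and outward unit normal nu,
   satisfies Stokes' theorem: the integral over the boundary of (the pullback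
   of) an (n-1)-form w is that of nu^flat /\ w against sigma, since
   nu^flat /\ i_F dV = (F . nu) dV. *)
Definition stokes_domain (sigma : {measure set 'rV[R]_n -> \bar R})
    (nu : vfield R n) : Prop :=
  [/\ [/\ open D, connected D & D !=set0],
      [/\ sigma (~` bdry) = 0%E,
          forall K, compact K -> (sigma K < +oo)%E &
          forall x O, bdry x -> open O -> O x -> (0 < sigma O)%E],
      measurable_fun bdry nu /\ (forall x, bdry x -> dotv (nu x) (nu x) = 1) &
      forall w, test_form setT w ->
        int_form D (ext_d w) =
        \int[sigma]_(x in bdry) top_coef (wedge (flat (nu x)) (w x))].

Context (sigma : {measure set 'rV[R]_n -> \bar R}) (nu : vfield R n).

(* The pullback of a covector a to the tangent hyperplane nu^perp vanishes iff
   nu^flat /\ a = 0.  Boundary values are limits from inside the domain of a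
   representative of the form. *)
Definition trace0 (k : nat) w := exists w', [/\ kform k w', form_eq w w' &
  {ae sigma, forall x, bdry x -> forall S,
    (fun y => wedge (flat (nu x)) (w' y) S) @ within D (nbhs x) --> (0 : R)}].

Definition tangent_field (X : vfield R n) : Prop :=
  measurable_fun D X /\
  {ae sigma, forall x, bdry x ->
    (fun y => dotv (X y) (nu x)) @ within D (nbhs x) --> (0 : R)}.

End domain.
End forms.

(* ** Discrete spaces and operators *)

(* The finite-dimensional spaces V_h^i and X_h are abstract finite-dimensional
   vector spaces with a linear realization of their elements as forms and vector
   fields.  Degrees range over nat: V_h^i = 0 for n < i, by [fe_complex] below. *)
Record discretization (R : realType) (n : nat) := Discretization {
  Vh : nat -> vectType R ;
  ev : forall i, {linear Vh i -> form R n} ;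
  dh : forall i, 'Hom(Vh i, Vh i.+1) ;
  Xh : vectType R ;
  eX : {linear Xh -> vfield R n} ;
  Pidom : nat -> set (form R n) ;
  Pi : forall i, form R n -> Vh i }.

Arguments ev {R n} d i.
Arguments Pi {R n} d i _.

Section discrete.
Context (R : realType) (n : nat) (D : set 'rV[R]_n).
Context (sigma : {measure set 'rV[R]_n -> \bar R}) (nu : vfield R n).
Context (H : discretization R n).

Local Notation Vh := (Vh H).
Local Notation Xh := (Xh H).
Local Notation ev := (ev H _).
Local Notation eX := (eX H).
Local Notation dh := (dh H).
Local Notation Pi := (Pi H).

(* [dh] is the exterior derivative, which maps V_h^i to V_h^(i+1). *)
Definition fe_complex : Prop :=
  [/\ forall i (a : Vh i), kform D i (ev a),
      forall i (a : Vh i), form_eq D (ev a) 0 -> a = 0 &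
      forall i (a : Vh i), is_ext_d D i (ev a) (ev (dh i a))].

Definition fe_fields : Prop :=
  (forall u : Xh, tangent_field D sigma nu (eX u)) /\
  (forall u : Xh, (forall x, D x -> eX u x = 0) -> u = 0).

(* The operators Pi^i are linear on their domains [Pidom], which contain V_h^i
   and the contractions i_u a of discrete forms; they fix V_h^i and preserve the
   vanishing of traces. *)
Definition fe_projections : Prop := forall i,
  [/\ [/\ forall w, Pidom H i w -> kform D i w,
          forall (c : R) w w', Pidom H i w -> Pidom H i w' ->
            Pidom H i (c *: w + w') /\ Pi i (c *: w + w') = c *: Pi i w + Pi i w' &
          forall w w', Pidom H i w -> Pidom H i w' -> form_eq D w w' ->
            Pi i w = Pi i w'],
      forall a : Vh i, Pidom H i (ev a) /\ Pi i (ev a) = a,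
      forall (u : Xh) (a : Vh i.+1), Pidom H i (iprod (eX u) (ev a)) &
      forall w, Pidom H i w -> trace0 D sigma nu i w ->
        trace0 D sigma nu i (ev (Pi i w))].

Definition graded_end := forall i, 'End(Vh i).

Definition gh (A : graded_end) : Prop :=
  forall i, (dh i \o A i)%VF = (A i.+1 \o dh i)%VF.

Definition bracket (A B : graded_end) : graded_end :=
  fun i => (A i \o B i - B i \o A i)%VF.

Definition A_ (u : Xh) : graded_end := fun i =>
  match i return 'End(Vh i) with
  | 0 => linfun (fun a : Vh 0 => Pi 0 (iprod (eX u) (ev (dh 0 a))))
  | j.+1 => linfun (fun a : Vh j.+1 =>
      dh j (Pi j (iprod (eX u) (ev a))) +
      Pi j.+1 (iprod (eX u) (ev (dh j.+1 a))))
  end.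

(* [hat] is a linear map on the Lie algebra [gh]; its values elsewhere are
   irrelevant. *)
Definition hat_left_inverse (hat : graded_end -> Xh) : Prop :=
  [/\ injective A_,
      forall (c : R) A B, gh A -> gh B ->
        hat (fun i => c *: A i + B i) = c *: hat A + hat B &
      forall u, hat (A_ u) = u].

End discrete.

(* ** The semi-discrete scheme *)

Section time.
Context (R : realType) (W : vectType R).
Implicit Types c : R -> W.

Definition tcoord c (i : 'I_(\dim {:W})) (t : R) : R :=
  coord (vbasis {:W}) i (c t).

(* Smooth in a neighbourhood of I, so that derivatives make sense at the
   endpoints of I, if any. *)
Definition smooth_curve (I : set R) c : Prop :=
  exists O : set R, [/\ open O, I `<=` O &
    forall i (k : nat) t, O t -> derivable (derive1n k (tcoord c i)) t 1].

Definition dt c (t : R) : W := \sum_i derive1 (tcoord c i) t *: (vbasis {:W})`_i.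

End time.

Section scheme.
Context (R : realType) (n : nat) (D : set 'rV[R]_n).
Context (H : discretization R n) (hat : graded_end H -> Xh H).
(* The internal energy e, as a function of (rho, s) in its domain E. *)
Context (E : set 'rV[R]_2) (e : 'rV[R]_2 -> R).

Definition pair_rV (r s : R) : 'rV[R]_2 := \row_i (if i == 0 then r else s).

Definition density (a : Vh H n) (x : 'rV[R]_n) : R := top_coef (ev H n a x).

Section curves.
Context (u : R -> Xh H) (rho vsig : R -> Vh H n) (beta : R -> Vh H n.-1).

Definition momentum_integrand (t : R) (v : Xh H) (x : 'rV[R]_n) : R :=
  let r := density (rho t) x in
  let rs := pair_rV r (density (vsig t) x) in
  let ux := eX H (u t) x in
  \sum_j derive1 (fun s => density (rho s) x * eX H (u s) x 0 j) t * eX H v x 0 j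
  - r * dotv ux (eX H (hat (bracket (A_ v) (A_ (u t)))) x)
  + (2^-1 * dotv ux ux - e rs - r * pder 0 e rs) * density (A_ v n (rho t)) x
  - r * pder 1 e rs * density (A_ v n (vsig t)) x
  - top_coef (wedge (ev H n.-1 (beta t) x)
               (hodge (ev H n.-1 (A_ v n.-1 (beta t)) x))).

Definition solution (I : set R) : Prop :=
  [/\ [/\ smooth_curve I u, smooth_curve I rho, smooth_curve I vsig &
          smooth_curve I beta],
      forall t, I t -> {ae lebesgue_rV R n, forall x, D x ->
        E (pair_rV (density (rho t) x) (density (vsig t) x))},
      forall t (v : Xh H), I t ->
        (lebesgue_rV R n).-integrable D (EFin \o momentum_integrand t v) /\
        \int[lebesgue_rV R n]_(x in D) momentum_integrand t v x = 0 &
      forall t, I t ->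
        [/\ dt rho t + A_ (u t) n (rho t) = 0,
            dt vsig t + A_ (u t) n (vsig t) = 0 &
            dt beta t + A_ (u t) n.-1 (beta t) = 0]].

End curves.
End scheme.

(* Main.v *)
Require Import Defs.
From HB Require Import structures.
From mathcomp Require Import all_boot all_order all_algebra.
From mathcomp Require Import all_classical all_reals all_analysis.
From mathcomp Require Import ring lra.
Import Order.TTheory GRing.Theory Num.Theory.
Import numFieldNormedType.Exports.
Local Open Scope classical_set_scope.
Local Open Scope ring_scope.

(** The closed discrete forms are invariant under the advection equation
    d/dt beta + A_u beta = 0, in any degree at least 1.  Apply d to
      A_u beta = d (Pi (i_u beta)) + Pi (i_u (d beta)):
    since d o d = 0, the curve y = d beta solves the linear equation
      y' = - d (Pi (i_u y)),
    whose coefficients are continuous in time because Pi (i_u y) is linear in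
    both u and y ([Pi_iprod_linearl], [Pi_iprod_linearr]) and u is a
    differentiable curve in a finite-dimensional space.  As y vanishes at time
    0, it vanishes identically ([linear_ode_eq0]): the squared Euclidean norm E
    of its coordinates satisfies |E'| <= M E on compact intervals, and
    Gronwall's argument, run forwards and backwards in time, applies
    ([gronwall_eq0]).

    The identity d o d = 0 on the discrete spaces ([dh_dh]) has to be derived
    from the weak definition of d: by duality it follows from
    d (d phi) = 0 for smooth test forms phi ([ext_d_ext_d]), hence from the
    symmetry of second partial derivatives ([derive_comm]). *)

(** * Sums of functions *)

Lemma is_derive_big (R : numFieldType) (V W : normedModType R) (J : Type)
    (s : seq J) (P : pred J) (F : J -> V -> W) (dF : J -> W) (x v : V) :
  (forall k, is_derive x v (F k) (dF k)) ->
  is_derive x v (fun y => \sum_(k <- s | P k) F k y) (\sum_(k <- s | P k) dF k).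
Proof.
move=> dFk; elim: s => [|a s IH].
  by rewrite big_nil; under eq_fun do rewrite big_nil; exact: is_derive_cst.
rewrite big_cons; under eq_fun do rewrite big_cons.
by case: (P a); [exact: is_deriveD|exact: IH].
Qed.

Lemma continuous_at_sum (R : numFieldType) (T : topologicalType) (W : normedModType R)
    (J : Type) (s : seq J) (P : pred J) (F : J -> T -> W) (x : T) :
  (forall k, {for x, continuous (F k)}) ->
  {for x, continuous (fun y => \sum_(k <- s | P k) F k y)}.
Proof. by move=> cF; apply: cvg_big => [|k _]; [exact: add_continuous|exact: cF]. Qed.

(** * Symmetry of second derivatives *)

Lemma is_derive_line (R : realType) (V : normedModType R) (f : V -> R)
    (x v : V) (t : R) :
  derivable f (x + t *: v) v ->
  is_derive t 1 (fun s => f (x + s *: v)) ('D_v f (x + t *: v)).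
Proof.
have E : (fun h : R => h^-1 *: (f (x + (h *: (1 : R) + t) *: v) - f (x + t *: v)))
       = (fun h => h^-1 *: ((f \o shift (x + t *: v)) (h *: v) - f (x + t *: v))).
  apply/funext => h /=; congr (_ *: (f _ - _)).
  by rewrite [h%:A]mulr1 scalerDl addrCA.
move=> df; apply: DeriveDef; first by rewrite /derivable /= E.
by rewrite /derive /= E.
Qed.

Lemma MVT_line (R : realType) (V : normedModType R) (f : V -> R) (x v : V)
    (h : R) : 0 < h -> (forall y, derivable f y v) ->
  exists2 c, 0 < c < h & f (x + h *: v) - f x = h * 'D_v f (x + c *: v).
Proof.
move=> h0 df; pose g s := f (x + s *: v).
have dg (s : R) : is_derive s 1 g ('D_v f (x + s *: v)) by exact: is_derive_line.
have [|c] := @MVT R g _ 0 h h0 (fun s _ => dg s).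
  by apply: derivable_within_continuous => s _; case: (dg s).
rewrite in_itv /= => ch; rewrite /g scale0r addr0 subr0 => E.
by exists c; rewrite // E mulrC.
Qed.

(** The second difference of [f] at [x] with steps [h *: v] and [h *: w] is a
    value of [h ^+ 2 * 'D_w ('D_v f)].  Exchanging [v] and [w] leaves the second
    difference unchanged. *)
Lemma MVT_second_difference (R : realType) (V : normedModType R) (f : V -> R) (x v w : V)
    (h : R) : 0 < h -> (forall y, derivable f y v) ->
    (forall y, derivable ('D_v f) y w) ->
  exists c d, [/\ 0 < c < h, 0 < d < h &
   f (x + h *: v + h *: w) - f (x + h *: v) - (f (x + h *: w) - f x)
   = h ^+ 2 * 'D_w ('D_v f) (x + c *: v + d *: w)].
Proof.
move=> h0 df ddf; pose p := fun y => f (y + h *: w) - f y.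
have dsh y : is_derive y v (fun z => f (z + h *: w)) ('D_v f (y + h *: w)).
  have E : (fun k : R => k^-1 *: (f (k *: v + y + h *: w) - f (y + h *: w)))
       = (fun k : R => k^-1 *: ((f \o shift (y + h *: w)) (k *: v) - f (y + h *: w))).
    by apply/funext => k /=; rewrite addrA.
  have := df (y + h *: w); rewrite /derivable => d.
  by apply: DeriveDef; [rewrite /derivable /= E|rewrite /derive /= E].
have dp y : is_derive y v p ('D_v f (y + h *: w) - 'D_v f y).
  by apply: is_deriveB; exact: derivableP.
have [c ch E1] := @MVT_line R V p x v h h0 (fun y => @ex_derive _ _ _ _ _ _ _ (dp y)).
have [d dh E2] := @MVT_line R V ('D_v f) (x + c *: v) w h h0 ddf.
exists c, d; split => //; rewrite -/(p (x + h *: v)) -/(p x) E1.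
by have := dp (x + c *: v) => dpx; rewrite derive_val E2 expr2 mulrA.
Qed.

Lemma ler_dist_halves (R : realFieldType) (p q z e : R) :
  `|p - z| < e / 2 -> `|q - z| < e / 2 -> `|p - q| <= e.
Proof.
move=> pz qz; apply: (le_trans (ler_distD z p q)).
by rewrite [leRHS](splitr e) ltW// ltrD// distrC.
Qed.

(** Schwarz's theorem. *)
Lemma derive_comm (R : realType) (V : normedModType R) (f : V -> R) (v w : V) x :
  (forall y, derivable f y v) -> (forall y, derivable f y w) ->
  (forall y, derivable ('D_v f) y w) -> (forall y, derivable ('D_w f) y v) ->
  {for x, continuous ('D_w ('D_v f))} -> {for x, continuous ('D_v ('D_w f))} ->
  'D_w ('D_v f) x = 'D_v ('D_w f) x.
Proof.
have swap (a b c d : R) : a - b - (c - d) = a - c - (b - d) by ring.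
move=> dv dw dvw dwv cvw cwv; apply/eqP; rewrite -subr_eq0 -normr_le0.
apply/ler_addgt0Pl => e e0; rewrite addr0.
have e2 : 0 < e / 2 by rewrite divr_gt0.
have /cvgrPdist_lt/(_ _ e2) H1 := cvw; have /cvgrPdist_lt/(_ _ e2) H2 := cwv.
have [r /= r0 Hr] := (nbhs_normP _ _).1 (filterI H1 H2).
(* Steps small enough for both intermediate points to stay within r of x. *)
have N0 : 0 < `|v| + `|w| + 1 by rewrite ltr_pwDr// addr_ge0.
pose h := r / (`|v| + `|w| + 1).
have h0 : 0 < h by rewrite divr_gt0.
have near_x c d : 0 < c < h -> 0 < d < h -> `|c *: v + d *: w| < r.
  move=> /andP[c0 ch] /andP[d0 dh]; rewrite (le_lt_trans (ler_normD _ _))//.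
  rewrite !normrZ !gtr0_norm//.
  have -> : r = h * `|v| + h * `|w| + h
    by rewrite -mulrDr -[X in _ + X]mulr1 -mulrDr divfK// gt_eqF.
  by rewrite -[ltLHS]addr0 ler_ltD// lerD// ler_wpM2r// ltW.
have [c [d [ch dh E1]]] := @MVT_second_difference R V f x v w h h0 dv dvw.
have [c' [d' [ch' dh' E2]]] := @MVT_second_difference R V f x w v h h0 dw dwv.
have E : 'D_w ('D_v f) (x + c *: v + d *: w) = 'D_v ('D_w f) (x + c' *: w + d' *: v).
  apply: (mulfI (lt0r_neq0 (exprn_gt0 2 h0))).
  by apply: etrans E2; apply: etrans (esym E1) _; rewrite swap (addrAC x).
have [/= A _] : _ /\ _ := Hr (x + c *: v + d *: w)
  ltac:(rewrite /ball_/= -addrA opprD addNKr normrN; exact: near_x).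
have [/= _ B] : _ /\ _ := Hr (x + c' *: w + d' *: v)
  ltac:(rewrite /ball_/= -addrA opprD addNKr normrN addrC; exact: near_x).
by rewrite E in A; exact: ler_dist_halves A B.
Qed.

(** * The exterior derivative squares to zero *)

Section smooth.
Context {R : realType} {n : nat}.
Implicit Types (f g : 'rV[R]_n -> R) (i j : 'I_n).

Lemma smooth_pder j {f} : smooth_on setT f -> smooth_on setT (pder j f).
Proof.
move=> sf s x _; have := sf (rcons s j) x I.
by rewrite /iter_pder foldr_rcons.
Qed.

Lemma smooth_derivable {f} x j : smooth_on setT f -> derivable f x (delta_mx 0 j).
Proof. by move=> /(_ [::] x I)[_]. Qed.

Lemma pder_sum (J : Type) (s : seq J) (P : pred J) (F : J -> 'rV[R]_n -> R) (j : 'I_n) x :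
  (forall k, smooth_on setT (F k)) ->
  pder j (fun y => \sum_(k <- s | P k) F k y) x = \sum_(k <- s | P k) pder j (F k) x.
Proof.
move=> sF; apply: (@derive_val _ _ _ _ _ _ _ (is_derive_big _ _ _ _ s P F _ x _ _)) => k.
exact/derivableP/smooth_derivable.
Qed.

Lemma pderZ (c : R) f j x : smooth_on setT f ->
  pder j (fun y => c * f y) x = c * pder j f x.
Proof. by move=> sf; rewrite /pder (deriveZ c)//; exact: smooth_derivable. Qed.

Lemma smoothZ (c : R) f : smooth_on setT f -> smooth_on setT (fun y => c * f y).
Proof.
move=> sf s.
have -> : iter_pder s (fun y => c * f y) = (fun y => c * iter_pder s f y).
  elim: s => // j s /= ->; apply/funext => y; apply: pderZ.
  move=> t z _; have := sf (t ++ s) z I.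
  by rewrite /iter_pder foldr_cat.
move=> x _; have [cf df] := sf s x I; split; last by move=> j; exact: derivableZ.
by apply: (continuousM (@cst_continuous _ _ c x) cf).
Qed.

Lemma smooth_sum (J : Type) (s : seq J) (P : pred J) (F : J -> 'rV[R]_n -> R) :
  (forall k, smooth_on setT (F k)) ->
  smooth_on setT (fun y => \sum_(k <- s | P k) F k y).
Proof.
move=> sF t.
have -> : iter_pder t (fun y => \sum_(k <- s | P k) F k y) =
   (fun y => \sum_(k <- s | P k) iter_pder t (F k) y).
  elim: t => // j t /= ->; apply/funext => y; apply: pder_sum => i.
  by move=> l z _; have := sF i (l ++ t) z I; rewrite /iter_pder foldr_cat.
move=> x _; split.
  by apply: continuous_at_sum => k; exact: (sF k t x I).1.
move=> j.
have dF k : is_derive x (delta_mx 0 j) (iter_pder t (F k))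
    ('D_(delta_mx 0 j) (iter_pder t (F k)) x).
  exact/derivableP/(sF k t x I).2.
by case: (is_derive_big _ _ _ _ s P _ _ _ _ dF).
Qed.

Lemma pder_comm i j f x : smooth_on setT f ->
  pder i (pder j f) x = pder j (pder i f) x.
Proof.
move=> sf; apply: derive_comm => [y|y|y|y||].
- exact: smooth_derivable.
- exact: smooth_derivable.
- exact/smooth_derivable/smooth_pder.
- exact/smooth_derivable/smooth_pder.
- exact: (sf [:: i; j] x I).1.
- exact: (sf [:: j; i] x I).1.
Qed.

(** Moving dx_j past the factor dx_i of dx_S costs a sign exactly when
    [i < j]. *)
Lemma sgn1D1 (i j : 'I_n) (S : {set 'I_n}) : i \in S ->
  sgn R [set j]%SET S = (-1) ^+ (i < j)%N * sgn R [set j]%SET (S :\ i)%SET.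
Proof.
move=> iS; rewrite /sgn -exprD; congr (_ ^+ _).
rewrite (cardsD1 (j, i)) !inE eqxx iS /=; congr addn.
apply: eq_card => -[a b]; rewrite !inE /= xpair_eqE.
by case: (a == j); case: (b == i); case: (b \in S).
Qed.

Lemma ext_d_ext_d (w : Defs.form R n) x U :
  (forall S, smooth_on setT (fun y => w y S)) -> ext_d (ext_d w) x U = 0.
Proof.
move=> sw; rewrite /ext_d.
pose F (j i : 'I_n) := sgn R [set j]%SET (U :\ j)%SET * sgn R [set i]%SET (U :\ j :\ i)%SET *
  pder j (pder i (fun y => w y (U :\ j :\ i)%SET)) x.
pose T : R := \sum_(j in U) \sum_(i in U | i != j) F j i.
have -> : \sum_(j in U) sgn R [set j]%SET (U :\ j)%SET * pder j
     (fun y => \sum_(i in (U :\ j)%SET) sgn R [set i]%SET (U :\ j :\ i)%SET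
          * pder i (fun z => w z (U :\ j :\ i)%SET) y) x = T.
  apply: eq_bigr => j jU; rewrite pder_sum; last first.
    by move=> i; apply/smoothZ/smooth_pder.
  rewrite mulr_sumr; apply: eq_big => [i|i _]; first by rewrite !inE andbC.
  by rewrite pderZ; [rewrite mulrA|exact: smooth_pder].
(* The terms indexed by (j, i) and (i, j) are opposite. *)
suff TN : T = - T.
  by apply/eqP; rewrite -[_ == 0](mulrn_eq0 _ 2) mulr2n {2}TN subrr.
rewrite [LHS](exchange_big_dep (mem U)); last by move=> ? ? _ /andP[].
rewrite -sumrN.
apply: eq_bigr => j; rewrite -[mem U j]/(j \in U) => jU; rewrite -sumrN.
apply: eq_big => [i|i /andP[iU /andP[_ ij]]].
  by rewrite (eq_sym j) jU.
rewrite /F (_ : U :\ i :\ j = U :\ j :\ i)%SET; last first.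
  by rewrite !finset.setDDl finset.setUC.
rewrite pder_comm// -!mulNr; congr (_ * _).
rewrite (sgn1D1 j i)//; last by rewrite !inE jU andbT.
rewrite (sgn1D1 i j (U :\ j)%SET)//; last by rewrite !inE iU andbT eq_sym.
rewrite (_ : U :\ i :\ j = U :\ j :\ i)%SET; last first.
  by rewrite !finset.setDDl finset.setUC.
move: ij; rewrite -(inj_eq val_inj); case: ltngtP => //= _ _; ring.
Qed.

Lemma smooth_ext_d (w : Defs.form R n) :
  (forall S, smooth_on setT (fun y => w y S)) ->
  forall S, smooth_on setT (fun y => ext_d w y S).
Proof. by move=> sw S; apply: smooth_sum => j; exact/smoothZ/smooth_pder. Qed.

Lemma test_form_ext_d (D : set 'rV[R]_n) (w : Defs.form R n) :
  test_form D w -> test_form D (ext_d w).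
Proof.
move=> [sw [K [cK KD w0]]]; split; first exact: smooth_ext_d.
exists K; split=> // x S Kx; apply: big1 => j _.
have /near_eq_derive E : \forall y \near x, w y (S :\ j)%SET = 0.
  have : nbhs x (~` K).
    apply: open_nbhs_nbhs; split; last exact: Kx.
    exact/closed_openC/(compact_closed (@norm_hausdorff _ 'rV[R]_n)).
  by apply: filterS => y Ky; exact: w0.
by rewrite /pder E derive_cst mulr0.
Qed.

End smooth.

(** The double derivative of [a] pairs with every test form phi to
    plus or minus the pairing of [a] with d (d phi) = 0, and a discrete form
    that vanishes as a current is zero. *)
Lemma dh_dh (R : realType) (n : nat) (D : set 'rV[R]_n) (H : discretization R n) :
  fe_complex D H -> forall i (a : Vh H i), dh H i.+1 (dh H i a) = 0.
Proof.
move=> [_ inj dP] i a; apply: inj => phi tphi.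
rewrite (dP _ _ _ tphi) (dP _ _ _ (test_form_ext_d _ _ tphi)).
have Z (w : 'rV[R]_n -> covector R n) : (forall x, w x = 0) -> int_form D w = 0.
  move=> w0; rewrite /int_form /Rintegral.
  by under eq_integral do rewrite w0; rewrite integral0.
rewrite !Z ?mulr0//.
- move=> x; apply/funext => U; rewrite /wedge big1// => S _.
  by rewrite mulr0 mul0r.
- move=> x; apply/funext => U; rewrite /wedge big1// => S _.
  rewrite ext_d_ext_d ?mulr0//; case: tphi => //.
Qed.

(** * Gronwall's argument for linear differential equations *)

(** Uniqueness holds in both directions of time: if [E] vanishes at one end of
    the interval, it vanishes at the other. *)
Lemma gronwall_eq0 (R : realType) (E : R -> R) (M a b : R) : a <= b ->
  (forall t, t \in `[a, b] -> derivable E t 1) ->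
  (forall t, t \in `[a, b] -> 0 <= E t) ->
  (forall t, t \in `[a, b] -> `|derive1 E t| <= M * E t) ->
  E a = 0 <-> E b = 0.
Proof.
move=> ab dE E0 dEM.
have aI : a \in `[a, b] by rewrite in_itv/= lexx.
have bI : b \in `[a, b] by rewrite in_itv/= lexx ab.
have dg (c t : R) : t \in `[a, b] -> is_derive t 1 (fun s => expR (c * s) * E s)
    (expR (c * t) * (derive1 E t + c * E t)).
  move=> tI; have dEt : is_derive t 1 E (derive1 E t).
    by rewrite derive1E; exact/derivableP/dE.
  have de : is_derive t 1 (expR \o ( *%R c)) (expR (c * t) * c).
    apply: is_derive1_comp.
    by apply: is_derive_eq; rewrite /GRing.scale/= mulr1.
  have := is_deriveM de dEt; rewrite /GRing.scale/= => H.
  by apply: (is_derive_eq H); ring.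
have sub t : t \in `]a, b[ -> t \in `[a, b] by exact: subset_itv_oo_cc.
have cg c : {within `[a, b], continuous (fun s => expR (c * s) * E s)}.
  by apply: derivable_within_continuous => t /(dg c)[].
have pos c t : (expR (c * t) * E t == 0) = (E t == 0).
  by rewrite mulf_eq0 gt_eqF// expR_gt0.
(* expR (- M * t) * E t is nonincreasing, expR (M * t) * E t is nondecreasing. *)
split => [Ea|Eb]; apply/eqP.
- rewrite -(pos (- M)) eq_le mulr_ge0 ?expR_ge0 ?E0// andbT.
  have := @ler0_derive1_le_cc R (fun s => expR (- M * s) * E s) a b _ _ (cg _) b a bI aI ab.
  rewrite Ea mulr0; apply.
    by move=> t /sub/(dg (- M))[].
  move=> t /sub tI; have := dg (- M) _ tI => dgt; rewrite derive1E derive_val.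
  rewrite mulr_ge0_le0 ?expR_ge0// mulNr subr_le0.
  by rewrite (le_trans (ler_norm _))// dEM.
- rewrite -(pos M) eq_le mulr_ge0 ?expR_ge0 ?E0// andbT.
  have := @ger0_derive1_le_cc R (fun s => expR (M * s) * E s) a b _ _ (cg _) a b aI bI ab.
  rewrite Eb mulr0; apply.
    by move=> t /sub/(dg M)[].
  move=> t /sub tI; have := dg M _ tI => dgt; rewrite derive1E derive_val.
  rewrite mulr_ge0 ?expR_ge0// -lerBlDr sub0r lerNl.
  by rewrite (le_trans _ (dEM _ tI))// -normrN ler_norm.
Qed.

Lemma normM_le_sqr (R : realDomainType) (p q e : R) :
  p * p <= e -> q * q <= e -> `|p * q| <= e.
Proof.
move=> pe qe; have := sqr_ge0 (p - q); have := sqr_ge0 (p + q).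
by rewrite !expr2 ler_norml => h1 h2; apply/andP; split; nra.
Qed.

Section curves.
Context {R : realType}.

Lemma coord_dt (W : vectType R) (c : R -> W) i t :
  coord (vbasis {:W}) i (dt c t) = derive1 (tcoord c i) t.
Proof. by rewrite /dt coord_sum_free// (basis_free (vbasisP _)). Qed.

(** A linear map acts on the coordinates of a curve through its matrix in the
    bases [vbasis]. *)
Lemma tcoord_lin (V W : vectType R) (f : 'Hom(V, W)) (c : R -> V) i t :
  tcoord (fun s => f (c s)) i t =
  \sum_(j < \dim {:V}) coord (vbasis {:W}) i (f (vbasis {:V})`_j) * tcoord c j t.
Proof.
rewrite /tcoord [in LHS](coord_vbasis (memvf (c t))) !linear_sum.
by apply: eq_bigr => j _; rewrite !linearZ /= mulrC.
Qed.

(** A linear map commutes with the time derivative. *)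
Lemma derivable_tcoord_lin (V W : vectType R) (f : 'Hom(V, W)) (c : R -> V) t :
  (forall j, derivable (tcoord c j) t 1) ->
  (forall i, derivable (tcoord (fun s => f (c s)) i) t 1) /\
  dt (fun s => f (c s)) t = f (dt c t).
Proof.
move=> dc.
have D i : is_derive t 1 (tcoord (fun s => f (c s)) i)
    (\sum_(j < \dim {:V}) coord (vbasis {:W}) i (f (vbasis {:V})`_j) * derive1 (tcoord c j) t).
  rewrite (_ : tcoord _ i = (fun s =>
    \sum_(j < \dim {:V}) coord (vbasis {:W}) i (f (vbasis {:V})`_j) * tcoord c j s)); last first.
    by apply/funext => s; exact: tcoord_lin.
  apply: is_derive_big => j; apply: is_deriveZ.
  by rewrite derive1E; exact: derivableP.
split=> [i|]; first by case: (D i).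
rewrite {2}/dt linear_sum.
rewrite [RHS](coord_vbasis (memvf _)) {1}/dt; apply: eq_bigr => i _; congr (_ *: _).
have Di := D i; rewrite derive1E derive_val linear_sum; apply: eq_bigr => j _.
by rewrite !linearZ /= mulrC.
Qed.

(** Uniqueness for y' = sum_k a_k(t) L_k y with continuous coefficients:
    a solution that vanishes at one time of the interval vanishes at any
    other. *)
Lemma linear_ode_eq0 (W : vectType R) (m : nat) (a : 'I_m -> R -> R) (L : 'I_m -> 'End(W))
    (y : R -> W) (I : set R) (t0 t1 : R) :
  is_interval I ->
  (forall t i, I t -> derivable (tcoord y i) t 1) ->
  (forall t k, I t -> {for t, continuous (a k)}) ->
  (forall t, I t -> dt y t = \sum_k a k t *: L k (y t)) ->
  I t0 -> I t1 -> y t0 = 0 -> y t1 = 0.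
Proof.
move=> itvI dy ca ode It0 It1.
(* the squared Euclidean norm of the coordinates *)
pose E t := \sum_i tcoord y i t * tcoord y i t.
have sq_ge0 i t : 0 <= tcoord y i t * tcoord y i t by rewrite -expr2 sqr_ge0.
have E_eq0 t : E t = 0 <-> y t = 0.
  split=> [/eqP|y0]; last first.
    by rewrite /E big1// => i _; rewrite /tcoord y0 linear0 mulr0.
  rewrite psumr_eq0 => [/allP Ei|i _]; last exact: sq_ge0.
  rewrite (coord_vbasis (memvf (y t))) big1// => i _.
  have /implyP/(_ isT) := Ei i (mem_index_enum _).
  by rewrite mulf_eq0 orbb => /eqP; rewrite /tcoord => ->; rewrite scale0r.
have E_ge0 t : 0 <= E t by apply: sumr_ge0 => i _; exact: sq_ge0.
have EM i j t : `|tcoord y i t * tcoord y j t| <= E t.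
  have le1 k : tcoord y k t * tcoord y k t <= E t.
    by rewrite /E (bigD1 k)//= lerDl sumr_ge0.
  exact: normM_le_sqr.
pose B i k j : R := coord (vbasis {:W}) i (L k (vbasis {:W})`_j).
pose C k := \sum_i \sum_(j < \dim {:W}) `|B i k j|.
have dyE t i : I t ->
    derive1 (tcoord y i) t = \sum_k a k t * \sum_(j < \dim {:W}) B i k j * tcoord y j t.
  move=> It; rewrite -coord_dt ode// linear_sum; apply: eq_bigr => k _.
  rewrite linearZ /=; congr (_ * _).
  rewrite [in LHS](coord_vbasis (memvf (y t))) !linear_sum.
  by apply: eq_bigr => j _; rewrite !linearZ /= mulrC.
have dE t : I t -> is_derive t 1 E (\sum_i 2 * (tcoord y i t * derive1 (tcoord y i) t)).
  move=> It; apply: is_derive_big => i.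
  have dyi : is_derive t 1 (tcoord y i) (derive1 (tcoord y i) t).
    by rewrite derive1E; exact/derivableP/dy.
  by apply: (is_derive_eq (is_deriveM dyi dyi)); rewrite mulr_natl mulr2n.
(* The rate of growth of E, up to the factor E; it is continuous in time. *)
pose N t := 2 * \sum_k `|a k t| * C k.
have dE_le t : I t -> `|derive1 E t| <= N t * E t.
  move=> It; have dEt := dE _ It; rewrite derive1E derive_val.
  rewrite -mulr_sumr normrM normr_nat /N -mulrA ler_wpM2l//.
  rewrite mulr_suml (le_trans (ler_norm_sum _ _ _))//.
  under [leRHS]eq_bigr do rewrite -mulrA mulr_suml mulr_sumr.
  rewrite exchange_big/=; apply: ler_sum => i _.
  rewrite (dyE _ _ It) mulr_sumr (le_trans (ler_norm_sum _ _ _))//.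
  apply: ler_sum => k _; rewrite mulrCA normrM ler_wpM2l//.
  rewrite mulr_sumr mulr_suml (le_trans (ler_norm_sum _ _ _))//.
  by apply: ler_sum => j _; rewrite mulrCA normrM ler_wpM2l.
have cN t : I t -> {for t, continuous N}.
  move=> It; apply: cvgM; first exact: cvg_cst.
  apply: continuous_at_sum => k; apply: cvgM; last exact: cvg_cst.
  by apply: cvg_norm; exact: ca.
have E0 s t : I s -> I t -> s <= t -> E s = 0 <-> E t = 0.
  move=> Is It st; have sub r : r \in `[s, t] -> I r.
    by rewrite in_itv/= => ?; exact: itvI Is It _ _.
  have [|c _ Nc] := @EVT_max R N s t st.
    by apply: continuous_in_subspaceT => r; rewrite inE/= => /sub/cN.
  apply: (@gronwall_eq0 R E (N c)) => // r rI; have Ir := sub _ rI.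
    by case: (dE _ Ir).
  by rewrite (le_trans (dE_le _ Ir))// ler_wpM2r// Nc.
move=> /E_eq0 Et0; apply/E_eq0; have [t01|/ltW t10] := leP t0 t1.
  exact/(E0 _ _ It0 It1 t01).
exact/(E0 _ _ It1 It0 t10).
Qed.
End curves.

(** * Preservation of closedness *)

Lemma linfunE (K : fieldType) (V W : vectType K) (f : V -> W) : linear f ->
  linfun f =1 f.
Proof.
move=> lf a; pose F : {linear V -> W} := HB.pack f (GRing.isLinear.Build _ _ _ _ f lf).
exact: (lfunE F a).
Qed.

Section advection.
Context {R : realType} {n : nat} {D : set 'rV[R]_n}.
Context {sigma : {measure set 'rV[R]_n -> \bar R}} {nu : vfield R n}.
Context {H : discretization R n}.

Lemma iprodZDl (c : R) (X Y : vfield R n) (w : Defs.form R n) :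
  iprod (c *: X + Y) w = c *: iprod X w + iprod Y w.
Proof.
apply/funext => x; apply/funext => U.
rewrite /iprod /contract !fctE /GRing.scale/= mulr_sumr -big_split/=.
by apply: eq_bigr => j _; rewrite !mxE; ring.
Qed.

Lemma iprodZDr (c : R) (X : vfield R n) (w w' : Defs.form R n) :
  iprod X (c *: w + w') = c *: iprod X w + iprod X w'.
Proof.
apply/funext => x; apply/funext => U.
rewrite /iprod /contract !fctE /GRing.scale/= mulr_sumr -big_split/=.
by apply: eq_bigr => j _; ring.
Qed.

(** The projected contraction Pi^i (i_u a). *)
Definition Pi_iprod i (u : Xh H) (a : Vh H i.+1) : Vh H i :=
  Pi H i (iprod (eX H u) (ev H i.+1 a)).

Lemma Pi_iprod_linearl (H2 : fe_projections D sigma nu H) i a : linear (fun u => Pi_iprod i u a).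
Proof.
move=> c u v; have [[_ lin _] _ dom _] := H2 i.
by rewrite /Pi_iprod linearP iprodZDl (lin _ _ _ (dom u a) (dom v a)).2.
Qed.

Lemma Pi_iprod_linearr (H2 : fe_projections D sigma nu H) i u : linear (Pi_iprod i u).
Proof.
move=> c a b; have [[_ lin _] _ dom _] := H2 i.
by rewrite /Pi_iprod linearP iprodZDr (lin _ _ _ (dom u a) (dom u b)).2.
Qed.

(** The discrete Cartan formula for the Lie derivative, in positive degree. *)
Lemma A_E (H2 : fe_projections D sigma nu H) i u a :
  A_ u i.+1 a = dh H i (Pi_iprod i u a) + Pi_iprod i.+1 u (dh H i.+1 a).
Proof.
rewrite /A_ linfunE// => c a' b.
rewrite -!/(Pi_iprod _ _ _) linearP !(Pi_iprod_linearr H2) linearP scalerDr.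
by rewrite addrACA.
Qed.

(** Closedness is preserved by the advection equation, over any interval of
    time and in any positive degree. *)
Lemma closed_transport (H2 : fe_projections D sigma nu H)
    (H1 : fe_complex D H) i (I : set R) (u : R -> Xh H)
    (beta : R -> Vh H i.+1) (t0 t1 : R) :
  is_interval I ->
  (forall t k, I t -> derivable (tcoord u k) t 1) ->
  (forall t k, I t -> derivable (tcoord beta k) t 1) ->
  (forall t, I t -> dt beta t + A_ (u t) i.+1 (beta t) = 0) ->
  I t0 -> I t1 -> dh H i.+1 (beta t0) = 0 -> dh H i.+1 (beta t1) = 0.
Proof.
move=> itvI du dbeta eqbeta.
pose y t := dh H i.+1 (beta t).
pose L (k : 'I_(\dim {:Xh H})) : 'End(Vh H i.+2) :=
  (- (dh H i.+1 \o linfun (Pi_iprod i.+1 (vbasis {:Xh H})`_k)))%VF.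
apply: (@linear_ode_eq0 _ _ _ (fun k => tcoord u k) L y) => //.
- move=> t k It; exact: (derivable_tcoord_lin _ _ _ _ _ (fun j => dbeta t j It)).1.
- move=> t k It; apply: differentiable_continuous.
  exact/derivable1_diffP/du.
- move=> t It.
  rewrite (derivable_tcoord_lin _ _ _ _ _ (fun j => dbeta t j It)).2.
  have /eqP := eqbeta t It; rewrite addr_eq0 => /eqP ->.
  rewrite (A_E H2) linearN linearD /= (dh_dh _ _ _ _ H1) add0r -/(y t).
  have -> : Pi_iprod i.+1 (u t) (y t) =
      \sum_k tcoord u k t *: Pi_iprod i.+1 (vbasis {:Xh H})`_k (y t).
    rewrite [in LHS](coord_vbasis (memvf (u t))).
    rewrite -(linfunE _ _ _ _ (Pi_iprod_linearl H2 _ (y t))) linear_sum.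
    by apply: eq_bigr => k _; rewrite linearZ/= linfunE//; exact: (Pi_iprod_linearl H2).
  rewrite linear_sum -sumrN; apply: eq_bigr => k _.
  rewrite /L opp_lfunE comp_lfunE linfunE; last exact: (Pi_iprod_linearr H2).
  by rewrite linearZ/= scalerN.
Qed.
End advection.

Theorem proposition6 (R : realType) (n : nat) (hn : n = 2%N \/ n = 3%N)
  (Omega : set 'rV[R]_n) (sigma : {measure set 'rV[R]_n -> \bar R})
  (nu : vfield R n) (hOmega : stokes_domain Omega sigma nu)
  (E : set 'rV[R]_2) (e : 'rV[R]_2 -> R) (hE : open E) (he : smooth_on E e)
  (H : discretization R n)
  (H1 : fe_complex Omega H)
  (H2 : fe_projections Omega sigma nu H)
  (HX : fe_fields Omega sigma nu H)
  (hat : graded_end H -> Xh H) (H3 : hat_left_inverse hat)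
  (I : set R) (hI : is_interval I) (hI0 : I 0)
  (u : R -> Xh H) (rho vsig : R -> Vh H n) (beta : R -> Vh H n.-1)
  (hsol : solution Omega hat E e u rho vsig beta I)
  (hbeta0 : dh H n.-1 (beta 0) = 0) :
  forall t, I t -> dh H n.-1 (beta t) = 0.
Proof.
move=> t It; have [[su _ _ sbeta] _ _ eqs] := hsol.
have smooth_derivable1 (W : vectType R) (c : R -> W) s k :
    smooth_curve I c -> I s -> derivable (tcoord c k) s 1.
  by move=> [B [_ IB dc]] /IB Bs; exact: (dc k 0%N s Bs).
have du s k : I s -> derivable (tcoord u k) s 1 by exact: smooth_derivable1.
have dbeta s k : I s -> derivable (tcoord beta k) s 1 by exact: smooth_derivable1.
have eqbeta s : I s -> dt beta s + A_ (u s) n.-1 (beta s) = 0 by move=> /eqs[].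
clear -H1 H2 hn hI hI0 hbeta0 It du dbeta eqbeta.
(* In both dimensions n.-1 is a successor: beta has positive degree. *)
by case: hn => [nE|nE]; subst n;
  exact: (closed_transport H2 H1 _ _ _ _ _ _ hI du dbeta eqbeta hI0 It hbeta0).
Qed.
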